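(* Let $Y$ be a non-zero finite-dimensional real normed space with $\operatorname{ed}(Y)=n$. Let $X$ be an arbitrary metric space with an equilateral subset $\{x_1,\ldots,x_m\}$ consisting of $m$ distinct points and having diameter $d$, where $m>n$. Denote $c_m:=c_m(Y)$. Then $$d_{GH}(X,Y)\geqslant\frac12\min\Bigl\{\frac d2,\ \frac{d\,c_m}{2+c_m}\Bigr\}>0.$$
   Context: A normed space is regarded as a metric space with the metric induced by its norm; $|ab|$ denotes the distance between points $a,b$ of a metric space. A subset of a metric space is called equilateral if all the distances between its distinct points are equal to each other. The equilateral dimension $\operatorname{ed}(X)$ of a metric space $X$ is the largest cardinality of an equilateral subset of $X$; it is a known fact that $\operatorname{ed}(V)\leqslant 2^k$ for every $k$-dimensional normed space $V$. Metric imbalance: for a non-zero finite-dimensional normed space $V$ and an integer $m\geqslant 3$, $c_m(V)$ is the supremum of all real numbers $c$ such that for every $m$-tuple $(v_1,\ldots,v_m)\in V^m$ of pairwise distinct points there exist pairwise distinct indices $i,j,k$ with $\left|\frac{\|v_i-v_k\|}{\|v_j-v_k\|}-1\right|\geqslant c$. (If $m>\operatorname{ed}(V)$ and $V\neq 0$, then $m\geqslant 3$, since $\operatorname{ed}(V)\geqslant 2$.) For a subset $A$ of a metric space $Z$ and $r>0$, let $U_r(A)=\bigcup_{a\in A}\{z\in Z : |az|<r\}$. The Hausdorff distance between non-empty subsets $A,B\subset Z$ is $d_H(A,B)=\inf\{r>0 : A\subset U_r(B),\ B\subset U_r(A)\}$ (with $\inf\emptyset=\infty$). The Gromov--Hausdorff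 distance $d_{GH}(X,Y)\in[0,\infty]$ between two arbitrary (not necessarily bounded) non-empty metric spaces $X,Y$ is the infimum of positive numbers $r$ such that there exist a metric space $Z$ and subsets $X',Y'\subset Z$ with $X'$ isometric to $X$, $Y'$ isometric to $Y$, and $d_H(X',Y')\leqslant r$ (with $\inf\emptyset=\infty$). *)

(* Defs.v *)
From HB Require Import structures.
From mathcomp Require Import all_boot all_order all_algebra.
From mathcomp Require Import all_classical all_reals all_analysis.

Set Implicit Arguments.
Unset Strict Implicit.
Unset Printing Implicit Defensive.

Import Order.TTheory GRing.Theory Num.Theory.
Import numFieldNormedType.Exports.

Local Open Scope classical_set_scope.
Local Open Scope ring_scope.

(* Finite-dimensional normed spaces: [vectType] carries the finite dimension,
   [normedModType] the norm. *)
#[short(type="normedVectType")]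
HB.structure Definition NormedVector (R : numDomainType) :=
  {V of NormedModule R V & Vector R V}.

(* [normedModType] does not inherit from [metricType], so the metric induced by
   the norm is attached to an alias of the carrier. *)
Definition norm_metric (R : numDomainType) (V : normedModType R) : Type := V.

Section NormMetric.
Variables (R : realType) (V : normedModType R).

Let dist (x y : V) : R := `|x - y|.

Let dist_ge0 x y : 0 <= dist x y.
Proof. exact: normr_ge0. Qed.

Let dist_positivity x y : dist x y = 0 -> x = y.
Proof. by move=> /eqP; rewrite normr_eq0 subr_eq0 => /eqP. Qed.

Let ballE x e : ball x e = [set y | dist x y < e].
Proof. by rewrite -ball_normE. Qed.

HB.instance Definition _ := PseudoMetric.copy (norm_metric V) V.
HB.instance Definition _ :=
  PseudoMetric_isMetric.Build R (norm_metric V) dist_ge0 dist_positivity ballE.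

End NormMetric.

Section MetricNotions.
Variable R : realType.

Definition equilateral (X : metricType R) (A : set X) : Prop :=
  forall x y x' y' : X, A x -> A y -> A x' -> A y' ->
    x <> y -> x' <> y' -> mdist x y = mdist x' y'.

(* n is the largest cardinality of an equilateral subset of X. *)
Definition is_equilateral_dim (X : metricType R) (n : nat) : Prop :=
  (exists2 A : set X, equilateral A & (A #= `I_n)%card) /\
  (forall A : set X, equilateral A -> (A #<= `I_n)%card).

Definition diam (X : metricType R) (A : set X) : \bar R :=
  ereal_sup [set (mdist p.1 p.2)%:E | p in A `*` A].

Definition neighborhood (Z : metricType R) (r : R) (A : set Z) : set Z :=
  \bigcup_(a in A) [set z | mdist a z < r].

Definition hausdorff_dist (Z : metricType R) (A B : set Z) : \bar R :=
  ereal_inf [set r%:E | r in [set r : R | [/\ 0 < r,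
    A `<=` neighborhood r B & B `<=` neighborhood r A]]].

Definition isometric_to (X Z : metricType R) (A : set Z) : Prop :=
  exists2 f : X -> Z,
    (forall x y, mdist (f x) (f y) = mdist x y) & range f = A.

Definition gromov_hausdorff_dist (X Y : metricType R) : \bar R :=
  ereal_inf [set r%:E | r in [set r : R | 0 < r /\
    exists (Z : metricType R) (X' Y' : set Z),
      [/\ isometric_to X X', isometric_to Y Y' &
          (hausdorff_dist X' Y' <= r%:E)%E]]].

(* The set is nonempty and bounded above as soon as V is nonzero and m >= 3,
   so that the real-valued [sup] is the genuine supremum in that case. *)
Definition metric_imbalance (m : nat) (V : normedModType R) : R :=
  sup [set c : R | forall v : 'I_m -> V, injective v ->
    exists i j k : 'I_m, [/\ i != j, j != k, i != k &
      c <= `| `|v i - v k| / `|v j - v k| - 1 |]].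

End MetricNotions.

(* Main.v *)
(* If X and Y are at Gromov-Hausdorff distance less than t, then X maps into Y
   with distances distorted by less than 2t.  For 2t <= d/2 the images of the
   points x_i are distinct, and every ratio of two distances between them
   differs from 1 by at most 4t / (d - 2t).  Hence c_m <= 4t / (d - 2t), that is,
   d c_m <= 2t (2 + c_m).  The constant c_m is positive because Y has no
   equilateral m-tuple: up to a similarity, nearly equilateral tuples stay in a
   compact set of separated tuples, where the failure to be equilateral has a
   positive minimum. *)
Require Import Defs.
From HB Require Import structures.
From mathcomp Require Import all_boot all_order all_algebra.
From mathcomp Require Import all_classical all_reals all_analysis.
From mathcomp Require Import lra.
Import Order.TTheory GRing.Theory Num.Theory.
Import numFieldNormedType.Exports.
Local Open Scope classical_set_scope.
Local Open Scope ring_scope.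

(** * Compactness of closed balls in a finite-dimensional normed space *)

Section FiniteDimension.
Variables (R : realType) (Y : normedVectType R).

Let e := vbasis {: Y}.

Let of_coord (w : 'rV[R]_(\dim {: Y})) : Y := \sum_i w 0 i *: e`_i.

Let of_coord_continuous : continuous of_coord.
Proof.
apply: continuous_big => [|i _ w]; first exact: add_continuous.
exact: (cvgZr_tmp (@coord_continuous R 1 _ 0 i w)).
Qed.

Let of_coordZ a w : of_coord (a *: w) = a *: of_coord w.
Proof.
by rewrite /of_coord scaler_sumr; apply: eq_bigr => i _; rewrite mxE scalerA.
Qed.

Let of_coord_eq0 w : of_coord w = 0 -> w = 0.
Proof.
move=> w0; apply/rowP => i; rewrite mxE -(coord_sum_free _ _ (basis_free (vbasisP {:Y}))).
by rewrite -/(of_coord w) w0 linear0.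
Qed.

Let of_coord_surj y : exists w, of_coord w = y.
Proof.
exists (\row_i coord e i y); rewrite [RHS](coord_vbasis (memvf y)).
by apply: eq_bigr => i _; rewrite mxE.
Qed.

Let norm_of_coord_continuous : continuous (fun w => `|of_coord w|).
Proof.
by move=> w; apply: continuous_comp; [exact: of_coord_continuous|exact: norm_continuous].
Qed.

(* The norm attains a positive minimum on the unit sphere of the coordinate
   sup norm. *)
Let of_coord_coercive : exists2 a : R, 0 < a & forall w, a * `|w| <= `|of_coord w|.
Proof.
pose S := [set w : 'rV[R]_(\dim {: Y}) | `|w| = 1].
(* The sphere is empty only when every [w] is zero, and then any constant works. *)
have [S0|/set0P S0] := eqVneq S set0.
  exists 1 => // w; have [->|w0] := eqVneq w 0; first by rewrite normr0 mulr0.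
  have : S (`|w|^-1 *: w) by rewrite /S /= normrZ normfV normr_id mulVf ?normr_eq0.
  by rewrite S0.
have cS : compact S.
  apply: bounded_closed_compact.
    by exists 1; split => // M M1 w /= ->; exact: ltW.
  apply: (@preimage_closed _ _ _ [set 1 : R]); last exact: closed_eq.
  by move=> w _; exact: norm_continuous.
have [w0 Sw0 w0min] := compact_EVT_min S0 cS (continuous_subspaceT norm_of_coord_continuous).
exists `|of_coord w0|.
  rewrite normr_gt0; apply/eqP => /of_coord_eq0 w00.
  by move: Sw0; rewrite w00 inE /S /= normr0 => /eqP; rewrite eq_sym oner_eq0.
move=> w; have [->|wN0] := eqVneq w 0; first by rewrite normr0 mulr0.
have : S (`|w|^-1 *: w) by rewrite /S /= normrZ normfV normr_id mulVf ?normr_eq0.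
move=> /mem_set/w0min; rewrite of_coordZ normrZ normfV normr_id.
by rewrite ler_pdivlMl ?normr_gt0// mulrC.
Qed.

(** By coercivity the ball comes from a closed set of coordinates bounded by [M / a], and
    Heine-Borel applies there. *)
Lemma compact_norm_le (M : R) : compact [set y : Y | `|y| <= M].
Proof.
have [a a0 aP] := of_coord_coercive.
have -> : [set y : Y | `|y| <= M] = of_coord @` [set w | `|of_coord w| <= M].
  apply/seteqP; split => [y /= yM|_ [w /= wM <-]//].
  by have [w yw] := of_coord_surj y; exists w; rewrite //= yw.
apply: continuous_compact; first exact: continuous_subspaceT.
apply: bounded_closed_compact.
  exists (M / a); split=> [|N MN w /= wM]; first exact: num_real.
  by rewrite (le_trans _ (ltW MN))// ler_pdivlMr// mulrC (le_trans (aP w)).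
apply: (@preimage_closed _ _ _ [set r : R | r <= M]); last exact: closed_le.
by move=> w _; exact: norm_of_coord_continuous.
Qed.

End FiniteDimension.

Lemma row_entry_continuous (T : topologicalType) (m : nat) (i : 'I_m) :
  continuous (fun v : 'rV[T]_m => v 0 i).
Proof.
move=> v A vA.
exists (fun _ k => if k == i then A else setT) => [j k|w /= /(_ 0 i)].
  by rewrite ord1; have [->|_] := eqVneq k i; [exact: vA|exact: filterT].
by rewrite eqxx.
Qed.

(** * Equilateral sets, and maps obtained from the Gromov-Hausdorff distance *)

Section Equilateral.
Variables (R : realType) (X : metricType R).

Lemma equilateral_dim_lt (n m : nat) (x : 'I_m -> X) :
  is_equilateral_dim X n -> (n < m)%N -> injective x -> ~ equilateral (range x).
Proof.
move=> [_ maxn] nm x_inj /maxn.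
have x_card : (range x #= `I_m)%card.
  apply: (card_eq_trans (B := [set: 'I_m])); last by rewrite card_eq_sym card_II.
  by apply: inj_card_eq => i j _ _; exact: x_inj.
by rewrite (card_le_eql x_card) card_le_II leqNgt nm.
Qed.

Lemma equilateral_pair (x : 'I_2 -> X) : equilateral (range x).
Proof.
have pair (i j : 'I_2) : x i <> x j -> mdist (x i) (x j) = mdist (x ord0) (x ord_max).
  have [->|] := eqVneq i j; first by [].
  case: i j => [[|[|i]] ip] [[|[|j]] jp]//= _ _.
    by congr mdist; congr x; exact: val_inj.
  by rewrite metric_sym; congr mdist; congr x; exact: val_inj.
by move=> _ _ _ _ [i _ <-] [j _ <-] [k _ <-] [l _ <-] /pair -> /pair ->.
Qed.

(* Two edges of a complete graph are linked by a chain of edges in which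
   consecutive ones share a vertex. *)
Lemma equilateral_of_adjacent (m : nat) (x : 'I_m -> X) :
  (forall i j k, i != k -> j != k -> mdist (x i) (x k) = mdist (x j) (x k)) ->
  equilateral (range x).
Proof.
move=> adj _ _ _ _ [i _ <-] [j _ <-] [k _ <-] [l _ <-] ij kl.
have neq a b : x a <> x b -> a != b by apply: contra_notN => /eqP ->.
(* If [k] differs from [j], the edge [kj] meets both [ij] and [kl]; otherwise these two already
   share a vertex. *)
have [kj|kj] := eqVneq k j; last first.
  rewrite (adj i k j (neq _ _ ij) kj) metric_sym (adj j l k); first exact: metric_sym.
    by rewrite eq_sym.
  by rewrite eq_sym neq.
rewrite {}kj in kl *; rewrite [RHS]metric_sym; apply: adj; first exact: neq.
by rewrite eq_sym neq.
Qed.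

Lemma equilateral_mdist (m : nat) (x : 'I_m -> X) (d : R) :
  (1 < m)%N -> injective x -> equilateral (range x) -> diam (range x) = d%:E ->
  0 < d /\ forall i j, i != j -> mdist (x i) (x j) = d.
Proof.
move=> m1 x_inj x_eq xd.
have neq i j : i != j -> x i <> x j by move=> /eqP ij /x_inj.
pose i0 := Ordinal (ltnW m1); pose i1 := Ordinal m1.
have xE i j : i != j -> mdist (x i) (x j) = mdist (x i0) (x i1).
  by move=> ij; apply: x_eq; [exists i|exists j|exists i0|exists i1|exact: neq|exact: neq].
have : diam (range x) = (mdist (x i0) (x i1))%:E.
  apply/eqP; rewrite eq_le; apply/andP; split.
    apply: ge_ereal_sup => _ [[_ _] [[i _ <-] [j _ <-]] <-]; rewrite lee_fin /=.
    have [->|/xE ->//] := eqVneq i j.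
    by rewrite mdistxx mdist_ge0.
  by apply: ereal_sup_ubound; exists (x i0, x i1).
rewrite xd => -[->]; split => //.
by rewrite mdist_gt0; apply/eqP; exact: neq.
Qed.

(** Send [a] to a point of [Y] whose copy in [Z] is within [t] of the copy of [a]; moving both
    endpoints changes a distance by less than [2 * t]. *)
Lemma gromov_hausdorff_lt (Y : metricType R) (r : R) :
  (gromov_hausdorff_dist X Y < r%:E)%E ->
  exists2 t, t < r &
    exists f : X -> Y, forall a b, `|mdist (f a) (f b) - mdist a b| < 2 * t.
Proof.
move=> /ereal_inf_lt[_ [s [_ [Z [_ [_ [[f fE <-] [g gE <-] fgs]]]]] <-]].
move=> /(le_lt_trans fgs)/ereal_inf_lt[_ [t [_ fg _] <-]]; rewrite lte_fin => tr.
have /choice[h hP] : forall a, exists b, mdist (g b) (f a) < t.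
  by move=> a; have [_ [b _ <-]] := fg _ (imageT f a); exists b.
exists t => //; exists h => a b; rewrite -gE -fE.
have := hP a; have := hP b.
move: (f a) (f b) (g (h a)) (g (h b)) => fa fb ga gb hb ha.
have := metric_triangle ga fa gb; have := metric_triangle fa fb gb.
have := metric_triangle fa ga fb; have := metric_triangle ga gb fb.
rewrite (metric_sym fb gb) (metric_sym fa ga) => ? ? ? ?.
by rewrite ltr_norml; apply/andP; split; lra.
Qed.

End Equilateral.

(** * Positivity of the metric imbalance, by compactness *)

Section MetricImbalance.
Variables (R : realType) (Y : normedVectType R) (m : nat).

Let imbalance_lb := [set c : R | forall v : 'I_m -> Y, injective v ->
  exists i j k : 'I_m, [/\ i != j, j != k, i != k &
    c <= `| `|v i - v k| / `|v j - v k| - 1 |]].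

Let dist_continuous (i j : 'I_m) : continuous (fun v : 'rV[Y]_m => `|v 0 i - v 0 j|).
Proof.
move=> v.
exact: (cvg_norm (cvgB (@row_entry_continuous Y m i v) (@row_entry_continuous Y m j v))).
Qed.

Let compact_separated (M e : R) :
  compact [set v : 'rV[Y]_m | (forall i, `|v 0 i| <= M) /\
    forall i j, i != j -> e <= `|v 0 i - v 0 j|].
Proof.
apply: (@compact_closedI _ [set v : 'rV[Y]_m | forall i, `|v 0 i| <= M]
  [set v | forall i j, i != j -> e <= `|v 0 i - v 0 j|]).
  by apply: (rV_compact (A := fun=> [set y | `|y| <= M])) => _; exact: compact_norm_le.
rewrite [X in closed X](_ : _ = \bigcap_(p in [set p : 'I_m * 'I_m | p.1 != p.2])
    ((fun v : 'rV[Y]_m => `|v 0 p.1 - v 0 p.2|) @^-1` [set r | e <= r])); last first.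
  by apply/seteqP; split=> [v vP [i j]|v vP i j ij]; [exact: vP|exact: (vP (i, j))].
apply: closed_bigI => -[i j] _; apply: preimage_closed; last exact: closed_ge.
by move=> v _; exact: dist_continuous.
Qed.

(** A continuous measure of the failure to be equilateral: it vanishes exactly when any two edges
    sharing a vertex have equal lengths. *)
Let defect (v : 'rV[Y]_m) : R :=
  \sum_(p : 'I_m * 'I_m * 'I_m | (p.1.1 != p.2) && (p.1.2 != p.2))
    `| `|v 0 p.1.1 - v 0 p.2| - `|v 0 p.1.2 - v 0 p.2| |.

Let defect_continuous : continuous defect.
Proof.
apply: continuous_big => [|p _ v]; first exact: add_continuous.
exact: (cvg_norm (cvgB (@dist_continuous _ _ v) (@dist_continuous _ _ v))).
Qed.

Hypothesis not_equilateral :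
  forall v : 'I_m -> norm_metric Y, injective v -> ~ equilateral (range v).

Let defect_gt0 (v : 'rV[Y]_m) :
  (forall i j, i != j -> 0 < `|v 0 i - v 0 j|) -> 0 < defect v.
Proof.
move=> v_sep; rewrite lt_neqAle sumr_ge0 ?andbT => [|p _]; last exact: normr_ge0.
apply/negP; rewrite eq_sym => /eqP v0; apply: (not_equilateral (fun i => v 0 i)).
  move=> i j vij; apply/eqP; apply: contraT => /v_sep.
  by rewrite vij subrr normr0 ltxx.
apply: equilateral_of_adjacent => i j k ik jk; apply/eqP.
rewrite -subr_eq0 -normr_eq0.
have /(_ (i, j, k)) := psumr_eq0P (fun _ _ => normr_ge0 _) v0.
by rewrite /= ik jk => ->.
Qed.

(** The minimum is attained on a compact set; the bounds 4 and 1/4 fit the normalised tuples of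
    [imbalance_lb_gt0]. *)
Let defect_lb : exists2 dlt : R, 0 < dlt & forall v : 'rV[Y]_m,
  (forall i, `|v 0 i| <= 4) ->
  (forall i j, i != j -> 4^-1 <= `|v 0 i - v 0 j|) -> dlt <= defect v.
Proof.
pose K := [set v : 'rV[Y]_m | (forall i, `|v 0 i| <= 4) /\
    forall i j, i != j -> (4^-1 : R) <= `|v 0 i - v 0 j|].
have [K0|/set0P K0] := eqVneq K set0.
  exists 1 => // v v4 v_sep.
  by have : K v by []; rewrite K0.
have [v0 /set_mem[_ v0_sep] v0min] := compact_EVT_min K0 (@compact_separated 4 4^-1)
  (continuous_subspaceT defect_continuous).
exists (defect v0); first by apply: defect_gt0 => i j /v0_sep; apply: lt_le_trans.
by move=> v v4 v_sep; apply: v0min; apply: mem_set.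
Qed.

Hypothesis m_gt2 : (2 < m)%N.

Let imbalance_lb_gt0 : exists2 c : R, 0 < c & imbalance_lb c.
Proof.
have [dlt dlt0 dltP] := defect_lb.
pose P := [pred p : 'I_m * 'I_m * 'I_m | (p.1.1 != p.2) && (p.1.2 != p.2)].
pose N : R := #|P|.+1%:R; have N0 : 0 < N by rewrite ltr0n.
(* The bound 1/2 keeps normalised edges between 1/4 and 4. Each term of the defect is then at most
   [4 * c], and the 5 makes their sum strictly less than [dlt]. *)
pose c := Num.min 2^-1 (dlt / (5 * N)).
have c0 : 0 < c by rewrite lt_min invr_gt0 ltr0n divr_gt0 ?mulr_gt0.
have c_half : c <= 2^-1 by rewrite ge_min lexx.
have cN : c * (5 * N) <= dlt by rewrite -ler_pdivlMr ?mulr_gt0// ge_min lexx orbT.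
exists c => // v v_inj; apply: contrapT => v_bal.
pose i0 := Ordinal (ltnW (ltnW m_gt2)); pose i1 := Ordinal (ltnW m_gt2).
pose a := `|v i1 - v i0|.
have v_gt0 i j : i != j -> 0 < `|v i - v j|.
  by rewrite normr_gt0 subr_eq0; apply: contra => /eqP/v_inj ->.
have a0 : 0 < a by exact: v_gt0.
(* Normalise by a similarity: [i0] goes to the origin and the edge from [i0] to [i1] gets length
   1. *)
pose w := \row_i (a^-1 *: (v i - v i0)).
pose D i j := `|w 0 i - w 0 j|.
have DE i j : D i j = `|v i - v j| / a.
  rewrite /D !mxE -scalerBr opprB addrA subrK normrZ normfV normr_id.
  by rewrite mulrC.
have DC i j : D i j = D j i by rewrite /D distrC.
have D_bal i j k : i != j -> j != k -> i != k -> `|D i k - D j k| < c * D j k.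
  move=> ij jk ik; rewrite !DE -mulrBl normrM normfV (ger0_norm (ltW a0)).
  rewrite mulrA ltr_pM2r ?invr_gt0//.
  rewrite -ltr_pdivrMr ?v_gt0// -[X in _ / X](ger0_norm (normr_ge0 _)) -normf_div.
  rewrite mulrBl divff ?gt_eqF ?v_gt0// ltNge; apply/negP => cv.
  by apply: v_bal; exists i, j, k.
have D10 : D i1 i0 = 1 by rewrite DE divff// gt_eqF.
(* Edges at [i0] are compared with the unit edge; below, any other edge [ij] is compared with the
   edge from [j] to [i0]. *)
have D_i0 i : i != i0 -> 2^-1 <= D i i0 <= 3 / 2.
  move=> i_0; have [->|i_1] := eqVneq i i1; first by rewrite D10; lra.
  have := D_bal i i1 i0 i_1 isT i_0.
  by rewrite D10 ltr_norml; lra.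
have D_le i j : i != j -> 4^-1 <= D i j <= 4.
  move=> ij; have [j0|j0] := eqVneq j i0.
    by have := D_i0 i; rewrite -j0 ij => /(_ isT); lra.
  have [i_0|i_0] := eqVneq i i0.
    by have := D_i0 j; rewrite -i_0 eq_sym ij DC => /(_ isT); lra.
  have := D_bal i i0 j i_0; rewrite eq_sym => /(_ j0 ij).
  have := D_i0 j j0; rewrite (DC i0) => /andP[]; move: (D j i0) (D i j) => p q p1 p2.
  have cp : c * p <= 2^-1 * p by rewrite ler_wpM2r//; lra.
  by rewrite ltr_norml; lra.
have : dlt <= defect w.
  apply: dltP => [i|i j /D_le/andP[]//].
  have -> : w 0 i = w 0 i - w 0 i0 by rewrite [in w 0 i0]mxE subrr scaler0 subr0.
  rewrite -/(D i i0); have [->|/D_le/andP[]//] := eqVneq i i0.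
  by rewrite /D subrr normr0.
apply/negP; rewrite -ltNge.
apply: (@le_lt_trans _ _ (\sum_(p in P) (4 * c))).
  apply: ler_sum => -[[i j] k] /= /andP[ik jk].
  have [->|ij] := eqVneq i j; first by rewrite subrr normr0; lra.
  rewrite (le_trans (ltW (D_bal _ _ _ ij jk ik)))// mulrC ler_wpM2r ?(ltW c0)//.
  by have /andP[] := D_le _ _ jk.
rewrite sumr_const -[_ *+ _]mulr_natr -mulrA.
have NP : #|P|%:R <= N by rewrite ler_nat.
have := ler_wpM2l (ltW c0) NP; have := mulr_gt0 c0 N0.
rewrite mulrCA in cN.
by move: (c * N) (c * _) cN => p q *; lra.
Qed.

Hypothesis Y_neq0 : exists y : Y, y != 0.

(** A single injective tuple, made of multiples of [y], bounds every admissible [c] by the sum of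
    its finitely many imbalances. *)
Let imbalance_lb_has_ubound : has_ubound imbalance_lb.
Proof.
have [y y0] := Y_neq0; pose v (i : 'I_m) := (i : nat)%:R *: y.
have v_inj : injective v.
  move=> i j /eqP; rewrite -subr_eq0 -scalerBl scaler_eq0 (negbTE y0) orbF subr_eq0.
  by rewrite eqr_nat => /eqP/val_inj.
exists (\sum_(p : 'I_m * 'I_m * 'I_m)
  `| `|v p.1.1 - v p.2| / `|v p.1.2 - v p.2| - 1|) => c /(_ v v_inj).
move=> [i [j [k [_ _ _ cle]]]]; apply: (le_trans cle).
by rewrite (bigD1 (i, j, k))//= lerDl sumr_ge0.
Qed.

Lemma metric_imbalance_gt0 : 0 < metric_imbalance m Y.
Proof.
have [c c0 cP] := imbalance_lb_gt0.
exact/(lt_le_trans c0)/ub_le_sup.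
Qed.

Lemma metric_imbalance_le (v : 'I_m -> Y) (b : R) : injective v ->
  (forall i j k, i != j -> j != k -> i != k ->
    `| `|v i - v k| / `|v j - v k| - 1 | <= b) ->
  metric_imbalance m Y <= b.
Proof.
move=> v_inj vb; apply: ge_sup; first by have [c _ ?] := imbalance_lb_gt0; exists c.
move=> c /(_ v v_inj) [i [j [k [ij jk ik cle]]]].
exact/(le_trans cle)/vb.
Qed.

End MetricImbalance.

(** * The lower bound on the Gromov-Hausdorff distance *)

Theorem theorem11 (R : realType) (Y : normedVectType R) (n : nat)
    (Y_neq0 : exists y : Y, y != 0)
    (edY : is_equilateral_dim (norm_metric Y) n)
    (X : metricType R) (m : nat) (x : 'I_m -> X) (d : R)
    (x_inj : injective x)
    (x_eq : equilateral (range x))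
    (x_diam : diam (range x) = d%:E)
    (n_lt_m : (n < m)%N) :
  let c := metric_imbalance m Y in
  let b := 2^-1 * Num.min (d / 2) (d * c / (2 + c)) in
  (b%:E <= gromov_hausdorff_dist X (norm_metric Y))%E /\ 0 < b.
Proof.
move=> c b.
(* The pair [0], [y] is equilateral, so [n] is at least 2 and [m] at least 3, as the imbalance
   requires. *)
have n_gt1 : (1 < n)%N.
  rewrite ltnNge; apply/negP => n1; have [y y0] := Y_neq0.
  pose p (i : 'I_2) : norm_metric Y := if i == 0 then 0 : Y else y.
  apply: (equilateral_dim_lt _ _ _ _ p edY n1 _ (equilateral_pair _ _ p)).
  move=> i j; case: i j => [[|[|i]] ip] [[|[|j]] jp]//=; rewrite /p/= => yE;
    try exact: val_inj; by move: y0; rewrite ?yE -?yE eqxx.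
have m_gt2 : (2 < m)%N := leq_ltn_trans n_gt1 n_lt_m.
have [d_gt0 xd] := equilateral_mdist _ _ _ _ _ (ltnW m_gt2) x_inj x_eq x_diam.
have not_eq v := equilateral_dim_lt _ (norm_metric Y) _ _ v edY n_lt_m.
have c_gt0 : 0 < c := metric_imbalance_gt0 _ _ _ not_eq m_gt2 Y_neq0.
have b_gt0 : 0 < b.
  by rewrite mulr_gt0 ?invr_gt0// lt_min !divr_gt0 ?mulr_gt0 ?addr_gt0.
split => //; rewrite leNgt; apply/negP => /gromov_hausdorff_lt[t tb [f fP]].
have b2 : 2 * b = Num.min (d / 2) (d * c / (2 + c)) by rewrite mulrA divff ?mul1r.
(* The first term of the minimum keeps [d - 2 * t] positive, so the images stay distinct; the second
   contradicts the bound on [c] below. *)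
have bd : 2 * b <= d / 2 by rewrite b2 ge_min lexx.
have bc : 2 * b * (2 + c) <= d * c.
  by rewrite -ler_pdivlMr ?addr_gt0// b2 ge_min lexx orbT.
pose v i : Y := f (x i).
have v_near i j : i != j -> `| `|v i - v j| - d| < 2 * t.
  by move=> ij; rewrite -(xd i j ij); exact: fP.
have v_lb i j : i != j -> d - 2 * t < `|v i - v j|.
  by move=> /v_near; rewrite ltr_norml; lra.
have dt : 0 < d - 2 * t by lra.
have v_inj : injective v.
  move=> i j vij; apply/eqP; apply: contraT => /v_lb.
  by rewrite vij subrr normr0; lra.
(* Two edges within [2 * t] of [d] differ by at most [4 * t], and the denominator of the ratio
   exceeds [d - 2 * t]. *)
have : c <= 4 * t / (d - 2 * t).
  apply: (metric_imbalance_le _ _ _ not_eq m_gt2 v _ v_inj) => i j k _ jk ik.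
  have vjk : 0 < `|v j - v k| by exact: lt_trans (v_lb _ _ jk).
  rewrite -[X in _ - X](divff (lt0r_neq0 vjk)) -mulrBl normrM normfV normr_id.
  rewrite ler_pM//; last by rewrite lef_pV2 ?posrE// ltW// v_lb.
  have := v_near _ _ jk; have := v_near _ _ ik.
  by rewrite !ltr_norml ler_norml; lra.
(* Clearing denominators gives [d * c <= 2 * t * (2 + c) < 2 * b * (2 + c) <= d * c], which is
   absurd. *)
have tbc : t * (2 + c) < b * (2 + c) by rewrite ltr_pM2r// addr_gt0.
by rewrite ler_pdivlMr//; lra.
Qed.
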